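(* Let $\Lambda\subset\mathbb{R}^n$ be a lattice of dimension (rank) $n$ which is $k$-cyclic with cyclicity factor $k$. Then $k$ divides $n$.
   Context: A lattice $\Lambda\subset\mathbb{R}^n$ of rank $n$ is the set of all integer linear combinations of $n$ linearly independent vectors of $\mathbb{R}^n$. The shift operator is the linear map $\rho:\mathbb{R}^n\to\mathbb{R}^n$, $\rho(c_1,\dots,c_n)=(c_n,c_1,\dots,c_{n-1})$. $\Lambda$ is called $k$-cyclic if $\rho^k(\Lambda)=\Lambda$. The cyclicity factor of $\Lambda$ is the smallest positive integer $k$ such that $\rho^k(\vec{x})\in\Lambda$ for every $\vec{x}\in\Lambda$. *)

(* Defs.v *)
From HB Require Import structures.
From mathcomp Require Import all_boot all_order all_algebra.
From mathcomp Require Import boolp classical_sets reals.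

Set Implicit Arguments.
Unset Strict Implicit.
Unset Printing Implicit Defensive.

Import Order.TTheory GRing.Theory Num.Theory.

Local Open Scope classical_set_scope.
Local Open Scope ring_scope.

Section CyclicLattices.
Variables (R : realType) (n : nat).
Implicit Types (L : set 'rV[R]_n) (k : nat).

Definition lattice_span (b : n.-tuple 'rV[R]_n) : set 'rV[R]_n :=
  [set x | exists z : 'I_n -> int, x = \sum_(i < n) tnth b i *~ z i].

Definition full_rank_lattice L : Prop :=
  exists2 b : n.-tuple 'rV[R]_n, free b & L = lattice_span b.

(* (c_1, ..., c_n) |-> (c_n, c_1, ..., c_(n-1)): [ord_pred] is the cyclic
   predecessor, sending index 0 to n - 1. *)
Definition cyclic_shift (c : 'rV[R]_n) : 'rV[R]_n := \row_j c 0 (ord_pred j).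

Fact cyclic_shift_is_linear : linear cyclic_shift.
Proof. by move=> a u v; apply/rowP => j; rewrite !mxE. Qed.

HB.instance Definition _ :=
  GRing.isLinear.Build R 'rV[R]_n 'rV[R]_n *:%R cyclic_shift cyclic_shift_is_linear.

Definition k_cyclic k L : Prop := iter k cyclic_shift @` L = L.

Definition shift_stable k L : Prop := forall x, L x -> L (iter k cyclic_shift x).

Definition cyclicity_factor L k : Prop :=
  [/\ (0 < k)%N, shift_stable k L
    & forall j : nat, (0 < j)%N -> shift_stable j L -> (k <= j)%N].

End CyclicLattices.

(* Main.v *)
(** The shift satisfies [rho^n = 1]. If [r = n mod k], then pulling [x] in [L]
    back along [rho^k] exactly [n / k] times, which [rho^k(L) = L] permits,
    gives [y] in [L] with [rho^r x = rho^n y = y]. Hence [rho^r] preserves [L],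
    and minimality of [k] forces [r = 0]. *)
Require Import Defs.
From HB Require Import structures.
From mathcomp Require Import all_boot all_order all_algebra.
From mathcomp Require Import boolp classical_sets reals.

Lemma val_iter_ordS (n m : nat) (i : 'I_n) :
  val (iter m (@ordS n) i) = ((i + m) %% n)%N.
Proof.
elim: m => [|m IHm]; first by rewrite addn0 modn_small.
by rewrite iterS /= IHm -addn1 modnDml addn1 addnS.
Qed.

(** Iterates of [ordS] have the closed form [(i + m) %% n], hence period [n]; this passes to
    [ord_pred] because [ord_pred] undoes [ordS]. *)
Lemma iter_ord_pred_period (n : nat) (i : 'I_n) : iter n (@ord_pred n) i = i.
Proof.
have ordS_period : iter n (@ordS n) i = i.
  by apply: val_inj; rewrite val_iter_ordS modnDr modn_small.
have iterK m : cancel (iter m (@ordS n)) (iter m (@ord_pred n)).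
  elim: m => // m IHm j.
  by rewrite iterSr iterS ordSK IHm.
by rewrite -[in LHS]ordS_period iterK.
Qed.

Lemma iter_cyclic_shiftE (R : realType) (n m : nat) (c : 'rV[R]_n) (j : 'I_n) :
  iter m (@cyclic_shift R n) c ord0 j = c ord0 (iter m (@ord_pred n) j).
Proof. by elim: m j => // m IHm j; rewrite iterS mxE IHm iterSr. Qed.

Lemma iter_cyclic_shift_period (R : realType) (n : nat) (c : 'rV[R]_n) :
  iter n (@cyclic_shift R n) c = c.
Proof.
by apply/rowP => j; rewrite iter_cyclic_shiftE iter_ord_pred_period.
Qed.

(** The equality in [k_cyclic] makes the [k]-fold shift map [L] onto itself, so each of the [q]
    steps back can stay in [L]. *)
Lemma k_cyclic_pullback {R : realType} {n k : nat} (q : nat) {L : set 'rV[R]_n} :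
  k_cyclic k L ->
  forall x, L x -> exists2 y, L y & iter (q * k) (@cyclic_shift R n) y = x.
Proof.
move=> L_cyclic; elim: q => [|q IHq] x Lx; first by exists x.
have [z Lz <-] : (image L (iter k (@cyclic_shift R n))) x by rewrite L_cyclic.
have [y Ly <-] := IHq z Lz.
by exists y => //; rewrite mulSn iterD.
Qed.

Theorem proposition6 (R : realType) (n k : nat) (L : set 'rV[R]_n)
    (L_lattice : full_rank_lattice L) (L_cyclic : k_cyclic k L)
    (L_factor : cyclicity_factor L k) :
  (k %| n)%N.
Proof.
have [k_gt0 _ k_min] := L_factor.
have stable_mod : shift_stable (n %% k) L.
  move=> x /(k_cyclic_pullback (n %/ k) L_cyclic)[y Ly <-].
  (* The exponents add up to [n %/ k * k + n %% k = n], a full period, which leaves [L y]. *)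
  by rewrite -iterD addnC -divn_eq iter_cyclic_shift_period.
rewrite /dvdn; case: posnP => // r_gt0.
by have := k_min _ r_gt0 stable_mod; rewrite leqNgt ltn_mod k_gt0.
Qed.
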